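(* Let $I_0(q,t)=1$ and, for $n\ge 1$, let $I_n(q,t)=\sum_{\pi\in\mathcal{S}_n(\underline{32}1)}q^{\mathrm{inv}(\pi)}t^{\mathrm{des}(\pi)}$. Then for every $n\geq 1$, $$I_n(q,t)=\sum_{k=0}^{n-2}t\,q^{n-k-1}\genfrac{[}{]}{0pt}{}{n-1}{k}_q I_k(q,t)+I_{n-1}(q,t).$$
   Context: $\mathcal{S}_n$ is the set of permutations $\pi=\pi_1\pi_2\cdots\pi_n$ of $[n]=\{1,\dots,n\}$. A permutation $\pi\in\mathcal{S}_n$ contains the vincular pattern $\underline{32}1$ if there are indices $i,j$ with $1\le i$, $i+1<j\le n$ and $\pi_i>\pi_{i+1}>\pi_j$ (the entries playing the roles of 3 and 2 must be adjacent); otherwise it avoids it. $\mathcal{S}_n(\underline{32}1)$ is the set of $\pi\in\mathcal{S}_n$ avoiding $\underline{32}1$. The inversion number is $\mathrm{inv}(\pi)=|\{(i,j): i<j,\ \pi_i>\pi_j\}|$. An index $i\in[n-1]$ is a descent of $\pi$ if $\pi_i>\pi_{i+1}$, and $\mathrm{des}(\pi)$ is the number of descents of $\pi$. $\genfrac{[}{]}{0pt}{}{n}{k}_q=\frac{(q;q)_n}{(q;q)_k(q;q)_{n-k}}$ is the Gaussian binomial coefficient, where $(q;q)_n=\prod_{i=1}^n(1-q^i)$. Here $q,t$ are indeterminates, and an empty sum is $0$. *)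

(* Defs.v *)
From mathcomp Require Import all_boot all_order all_fingroup all_algebra.
Set Implicit Arguments.
Unset Strict Implicit.
Unset Printing Implicit Defensive.
Import GRing.Theory.
Local Open Scope ring_scope.

(* A permutation pi_1 ... pi_n of [n] is a permutation s of 'I_n: positions and
   values are both shifted down by one. *)

Definition contains_vincular321 (n : nat) (s : 'S_n) : bool :=
  [exists i : 'I_n, [exists i' : 'I_n, [exists j : 'I_n,
    [&& (i' == i.+1 :> nat)%N, (i' < j)%N, (s i' < s i)%N & (s j < s i')%N]]]].

Definition avoiders (n : nat) : {set 'S_n} :=
  [set s : 'S_n | ~~ contains_vincular321 s].

Definition perm_inv (n : nat) (s : 'S_n) : nat :=
  #|[set p : 'I_n * 'I_n | (p.1 < p.2)%N && (s p.2 < s p.1)%N]|.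

Definition perm_des (n : nat) (s : 'S_n) : nat :=
  #|[set i : 'I_n | [exists i' : 'I_n,
      (i' == i.+1 :> nat)%N && (s i' < s i)%N]]|.

(* Z[q,t] is represented as (Z[q])[t]; the Gaussian binomials are quotients in
   its field of fractions Q(q,t). *)
Notation Zqt := {poly {poly int}}.
Notation Qqt := {fraction Zqt}.

Definition q : Zqt := 'X%:P.
Definition t : Zqt := 'X.

Definition Ipol (n : nat) : Zqt :=
  if n is 0 then 1 else \sum_(s in avoiders n) q ^+ perm_inv s * t ^+ perm_des s.

Definition qpoch (n : nat) : Zqt := \prod_(1 <= i < n.+1) (1 - q ^+ i).

(* Only used for k <= n; for k > n the truncated n - k makes it meaningless. *)
Definition qbinom (n k : nat) : Qqt :=
  tofrac (qpoch n) / (tofrac (qpoch k) * tofrac (qpoch (n - k))).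

(* Main.v *)
Require Import Defs.
From mathcomp Require Import all_boot all_order all_fingroup all_algebra.
From mathcomp Require Import ring.
Import GRing.Theory.
Local Open Scope ring_scope.

(** The idea is to cut an avoiding permutation at its minimum.  Write a word with
    distinct letters as [B x w], where [x] is its smallest letter.  A descent
    inside [B] would be followed by the smaller letter [x], so avoidance forces
    [B] to be increasing; conversely, if [B] is increasing then the only descent
    ending at or before [x] is the one from the last letter of [B] to [x], and
    nothing lies below [x].  So [B x w] avoids the pattern exactly when [B] is
    increasing and [w] avoids it ([wavoids_min]).  The inversions of [B x w] are
    those of [w], the [size B] pairs ending in [x], and the pairs with one letter
    in [B] and a smaller one in [w], whose number [cross B w] depends only on the
    two sets of letters ([winv_min]); the descents are those of [w], plus one
    unless [B] is empty ([wdes_min]).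

    For a fixed alphabet, choosing an avoiding word therefore amounts to splitting
    the letters other than [x] into [B] and its complement [C], and choosing an
    avoiding arrangement of [C] ([perm_avoiders]).  The generating function of
    [cross] over the splittings with [C] of size [k] is the Gaussian binomial
    coefficient ([sum_splits], from the q-Pascal rule obtained by deciding on which
    side the smallest letter goes).  By induction the sum over the arrangements of
    [C] depends only on [k] ([wsum_size]), so it is I_k and no relabelling of
    letters is ever performed.  With [k = n - 1 - size B] this gives the
    recurrence: the term of empty [B], where [k = n - 1], is I_(n-1), and the
    others carry the factor t q^(n-1-k).

    Words are sequences of natural numbers here; [perm_word] identifies the
    permutations of ['I_n] with the arrangements of [iota 0 n]. *)

(** * Words and their statistics *)

Fixpoint winv (w : seq nat) : nat :=
  if w is x :: w' then (count (ltn^~ x) w' + winv w')%N else 0%N.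

Fixpoint wdes (w : seq nat) : nat :=
  if w is x :: w' then ((if w' is y :: _ then y < x : nat else 0) + wdes w')%N
  else 0%N.

(** The adjacent letters that play 3 and 2 are the first two of some suffix, so
    a descent at the head of a suffix must bottom out at a minimum of that suffix. *)
Fixpoint wavoids (w : seq nat) : bool :=
  if w is x :: w' then
    (if w' is y :: w'' then (y < x)%N ==> all (leq y) w'' else true) && wavoids w'
  else true.

Definition weight (w : seq nat) : Zqt := q ^+ winv w * t ^+ wdes w.

Definition wsum (s : seq nat) : Zqt :=
  \sum_(w <- permutations s | wavoids w) weight w.

(** * Gaussian binomial coefficients *)

(** The Gaussian binomial coefficient defined by the q-Pascal rule, which keeps it
    in Z[q,t]; it agrees with the quotient of q-factorials by [qbinom_gauss]. *)
Fixpoint gauss (n k : nat) : Zqt :=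
  match n, k with
  | _, 0 => 1
  | 0, _.+1 => 0
  | n'.+1, k'.+1 => gauss n' k'.+1 + q ^+ (n' - k') * gauss n' k'
  end.

Lemma gauss0 n : gauss n 0 = 1.
Proof. by case: n. Qed.

Lemma gauss_small n k : (n < k)%N -> gauss n k = 0.
Proof.
elim: n k => [|n IHn] [|k] //= lt_nk.
by rewrite !IHn ?mulr0 ?addr0 // ltnW.
Qed.

Lemma gauss_diag n : gauss n n = 1.
Proof. by elim: n => //= n IHn; rewrite subnn IHn mulr1 gauss_small ?add0r. Qed.

Lemma qpochS n : qpoch n.+1 = qpoch n * (1 - q ^+ n.+1).
Proof. by rewrite /qpoch big_nat_recr. Qed.

Lemma qpoch0 : qpoch 0 = 1.
Proof. by rewrite /qpoch big_nil. Qed.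

Lemma qpoch_neq0 n : qpoch n != 0.
Proof.
elim: n => [|n IHn]; first by rewrite qpoch0 oner_eq0.
rewrite qpochS mulf_neq0 // subr_eq0 /q -polyC_exp -polyC1 (inj_eq polyC_inj).
rewrite eq_sym; apply/eqP => /(congr1 (fun p : {poly int} => size p)).
by rewrite size_polyXn size_poly1.
Qed.

(** The q-factorial formula follows from the q-Pascal rule because
    (1 - q^a) + q^a (1 - q^b) = 1 - q^(a + b), with a = n - k and b = k + 1. *)
Lemma gaussE n k : (k <= n)%N -> gauss n k * (qpoch k * qpoch (n - k)) = qpoch n.
Proof.
elim: n k => [|n IHn] [|k] //; rewrite ?gauss0 ?qpoch0 ?subn0 ?mul1r //.
rewrite ltnS leq_eqVlt => /predU1P[-> | lt_kn].
  by rewrite gauss_diag subnn qpoch0 mulr1 mul1r.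
have /= IH1 := IHn k.+1 lt_kn; have /= IH0 := IHn k (ltnW lt_kn).
have Dm : (n - k = (n - k.+1).+1)%N by rewrite subnSK.
have Dq : q ^+ n.+1 = q ^+ (n - k) * q ^+ k.+1.
  by rewrite -exprD addnS subnK // ltnW.
rewrite subSS [in RHS]qpochS Dq.
move: IH1 IH0; rewrite {1 3}Dm !qpochS -Dm => IH1 IH0.
set P := qpoch n in IH1 IH0 *.
transitivity (P * (1 - q ^+ (n - k)) + q ^+ (n - k) * (1 - q ^+ k.+1) * P).
  by rewrite -{1}IH1 -IH0; ring.
by ring.
Qed.

Lemma qbinom_gauss n k : (k <= n)%N -> qbinom n k = tofrac (gauss n k).
Proof.
move=> le_kn; rewrite /qbinom -(gaussE n k le_kn).
by rewrite !tofracM mulfK // mulf_neq0 // tofrac_eq0 qpoch_neq0.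
Qed.

(** * Splitting an alphabet into a prefix set and a suffix set *)

Fixpoint splits (s : seq nat) : seq (seq nat * seq nat) :=
  if s is x :: s' then
    [seq (x :: p.1, p.2) | p <- splits s'] ++ [seq (p.1, x :: p.2) | p <- splits s']
  else [:: ([::], [::])].

Definition cross (B C : seq nat) : nat := (\sum_(b <- B) count (ltn^~ b) C)%N.

Lemma splits_perm s B C : (B, C) \in splits s -> perm_eq (B ++ C) s.
Proof.
elim: s B C => [|x s IHs] B C /=; first by rewrite inE => /eqP[-> ->].
rewrite mem_cat => /orP[] /mapP[[B' C'] /IHs IH [-> ->]] /=.
  by rewrite perm_cons.
by rewrite -cat1s perm_catCA /= perm_cons.
Qed.

Lemma splits_subseq s B C :
  (B, C) \in splits s -> subseq B s /\ subseq C s.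
Proof.
elim: s B C => [|x s IHs] B C /=; first by rewrite inE => /eqP[-> ->].
rewrite mem_cat => /orP[] /mapP[[B' C'] /IHs[sB sC] [-> ->]] /=; rewrite ?eqxx.
  by split => //; apply: subseq_trans sC (subseq_cons s x).
by split => //; apply: subseq_trans sB (subseq_cons s x).
Qed.

(** This is how a given word finds its splitting: take for [a] membership in the
    part of the word before the minimum. *)
Lemma mem_splits_filter (a : pred nat) s :
  ([seq x <- s | a x], [seq x <- s | ~~ a x]) \in splits s.
Proof.
elim: s => //= x s IHs; rewrite mem_cat.
case: (a x) => /=; apply/orP; [left | right]; apply/mapP.
  by exists ([seq x <- s | a x], [seq x <- s | ~~ a x]).
by exists ([seq x <- s | a x], [seq x <- s | ~~ a x]).
Qed.

Lemma splits_uniq s : uniq s -> uniq (splits s).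
Proof.
elim: s => //= x s IHs /andP[x_s /IHs Us].
rewrite cat_uniq !map_inj_uniq ?Us ?andbT /=; last 2 first.
- by move=> [B C] [B' C'] [-> ->].
- by move=> [B C] [B' C'] [-> ->].
apply/hasPn => _ /mapP[[B C] sBC ->]; apply/mapP => -[[B' C'] sBC' [_ eqC]].
have [_ /mem_subseq sC] := splits_subseq _ _ _ sBC'.
by case/negP: x_s; apply: sC; rewrite /= in eqC; rewrite -eqC mem_head.
Qed.

Lemma perm_cross B C C' : perm_eq C C' -> cross B C = cross B C'.
Proof. by move=> /seq.permP eqC; apply: eq_bigr => b _; apply: eqC. Qed.

Lemma cross_cons x B C : all (ltn x) B -> cross B (x :: C) = (size B + cross B C)%N.
Proof.
move=> /allP ltB; rewrite -sum1_size /cross -big_split /=.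
by apply: eq_big_seq => b /ltB /= ->.
Qed.

(** Deciding where the smallest letter [x] goes yields the q-Pascal rule: in the
    suffix set it lies below every letter of the prefix set, of which there are
    [size s - size C], and in the prefix set it lies above nothing.  The arbitrary
    weight [g] lets the induction absorb the shift of [size C]. *)
Lemma sum_splits s (g : nat -> Zqt) : sorted ltn s ->
  \sum_(p <- splits s) q ^+ cross p.1 p.2 * g (size p.2)
    = \sum_(k < (size s).+1) gauss (size s) k * g k.
Proof.
elim: s g => [|x s IHs] g /=.
  by rewrite big_seq1 /cross big_nil big_ord1.
move=> xs; have ss := path_sorted xs; have lt_x := order_path_min ltn_trans xs.
rewrite big_cat !big_map /=.
have cross1 p : p \in splits s -> cross (x :: p.1) p.2 = cross p.1 p.2.
  case: p => B C /splits_subseq[_ /mem_subseq sC] /=.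
  rewrite /cross big_cons (eq_in_count (a2 := pred0)) ?count_pred0 // => c.
  by move=> /sC /(allP lt_x) /= lt_xc; rewrite ltnNge ltnW.
have cross2 p : p \in splits s ->
    (cross p.1 (x :: p.2) = cross p.1 p.2 + (size s - size p.2))%N.
  case: p => B C sBC /=; have [/mem_subseq sB _] := splits_subseq _ _ _ sBC.
  rewrite -(perm_size (splits_perm _ _ _ sBC)) size_cat addnK addnC cross_cons //.
  by apply/allP => b /sB; apply: (allP lt_x).
rewrite (eq_big_seq (fun p => q ^+ cross p.1 p.2 * g (size p.2))); last first.
  by move=> p /cross1->.
rewrite [X in _ + X](eq_big_seq (fun p =>
    q ^+ cross p.1 p.2 * (q ^+ (size s - size p.2) * g (size p.2).+1))); last first.
  by move=> p /cross2->; rewrite exprD mulrA.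
rewrite (IHs g ss) (IHs (fun k => q ^+ (size s - k) * g k.+1) ss).
rewrite [in RHS]big_ord_recl /= [in LHS]big_ord_recl /= -addrA gauss0; congr (_ + _).
under [in RHS]eq_bigr => k _ do rewrite mulrDl.
rewrite big_split /=; congr (_ + _); last first.
  by apply: eq_bigr => k _; rewrite mulrCA mulrA.
by rewrite [in RHS]big_ord_recr /= gauss_small // mul0r addr0.
Qed.

(** * Cutting a word at its minimum *)

Lemma winv_cat u v : winv (u ++ v) = (winv u + cross u v + winv v)%N.
Proof.
elim: u => [|x u IHu] /=; first by rewrite /cross big_nil.
by rewrite IHu /cross big_cons count_cat; ring.
Qed.

Lemma winv_sorted u : sorted leq u -> winv u = 0%N.
Proof.
elim: u => //= x u IHu xu; rewrite IHu ?(path_sorted xu) // addn0.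
apply/eqP; rewrite -leqn0 leqNgt -has_count; apply/hasPn => y uy.
by rewrite -leqNgt; apply: (allP (order_path_min leq_trans xu)).
Qed.

Lemma winv_min B x w : all (ltn x) B -> all (ltn x) w -> sorted leq B ->
  winv (B ++ x :: w) = (cross B w + size B + winv w)%N.
Proof.
move=> ltB ltw sB; rewrite winv_cat winv_sorted // cross_cons //= (@eq_in_count _ _ pred0).
  by rewrite count_pred0; ring.
by move=> y /(allP ltw) /= lt_xy; rewrite ltnNge ltnW.
Qed.

Lemma wdes_min B x w : all (ltn x) B -> all (ltn x) w -> sorted leq B ->
  wdes (B ++ x :: w) = ((B != [::]) + wdes w)%N.
Proof.
move=> + ltw; elim: B => [|b B IHB] /=.
  by case: w ltw => //= y w /andP[lt_xy _] _ _; rewrite ltnNge ltnW.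
move=> /andP[lt_xb ltB] sB; rewrite IHB ?(path_sorted sB) //.
case: B ltB sB {IHB} => [|b' B] /=; first by rewrite lt_xb.
by move=> _ /andP[le_bb' _]; rewrite ltnNge le_bb'.
Qed.

(** A descent inside [B] together with [x] is an occurrence of the pattern, while
    the descent onto [x] is harmless, [x] being minimal. *)
Lemma wavoids_min B x w : all (ltn x) B -> all (ltn x) w ->
  wavoids (B ++ x :: w) = sorted leq B && wavoids w.
Proof.
move=> + ltw; elim: B => [|b B IHB] /=.
  by case: w ltw => //= y w /andP[lt_xy _] _; rewrite ltnNge ltnW.
move=> /andP[lt_xb ltB]; rewrite IHB //.
case: B ltB {IHB} => [|b' B] /=.
  by rewrite (sub_all _ ltw) ?implybT // => y /ltnW.
move=> /andP[lt_xb' _]; rewrite all_cat /= (leqNgt b' x) lt_xb' andbF implybF.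
by rewrite -leqNgt andbA.
Qed.

Lemma splits_sorted x s B C : sorted ltn (x :: s) -> (B, C) \in splits s ->
  [/\ all (ltn x) B, all (ltn x) C, sorted leq B & sorted ltn C].
Proof.
move=> xs; have ss := path_sorted xs; have lt_x := order_path_min ltn_trans xs.
move=> sBC; have [sB sC] := splits_subseq _ _ _ sBC.
split; rewrite ?(subseq_sorted ltn_trans sC ss) //.
- by apply/allP => y /(mem_subseq sB); apply: (allP lt_x).
- by apply/allP => y /(mem_subseq sC); apply: (allP lt_x).
by move: (subseq_sorted ltn_trans sB ss); rewrite ltn_sorted_uniq_leq => /andP[].
Qed.

(** Cutting at the minimum is a bijection: [B] and [w] are what precedes and what
    follows [x] in the word, and [C] is [w] put in increasing order. *)
Lemma perm_avoiders x s : sorted ltn (x :: s) ->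
  perm_eq [seq w <- permutations (x :: s) | wavoids w]
          [seq p.1 ++ x :: w | p <- splits s,
                               w <- [seq w <- permutations p.2 | wavoids w]].
Proof.
move=> xs; have ss := path_sorted xs; have /allP lt_x := order_path_min ltn_trans xs.
have Us := sorted_uniq ltn_trans ltnn ss.
apply: uniq_perm.
- by rewrite filter_uniq ?permutations_uniq.
- apply: allpairs_uniq_dep; rewrite ?splits_uniq //.
    by move=> p _; rewrite filter_uniq ?permutations_uniq.
  move=> _ _ /allpairsPdep[[B C] [w [sBC + ->]]] /allpairsPdep[[B' C'] [w' [sBC' + ->]]] /=.
  rewrite !mem_filter !mem_permutations => /andP[_ Cw] /andP[_ Cw'] eqw.
  have [ltB _ _ sC] := splits_sorted _ _ _ _ xs sBC.
  have [ltB' _ _ sC'] := splits_sorted _ _ _ _ xs sBC'.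
  have idx u v : all (ltn x) u -> index x (u ++ x :: v) = size u.
    move=> /allP ltu; rewrite index_cat /= eqxx addn0 ifN //.
    by apply/negP => /ltu /=; rewrite ltnn.
  have szB : size B = size B' by rewrite -(idx B w) // eqw idx.
  move/eqP: eqw; rewrite eqseq_cat // eqseq_cons eqxx => /andP[/eqP eqB /eqP eqw].
  subst B' w'; suff -> : C = C' by [].
  apply: (irr_sorted_eq ltn_trans ltnn) => //; apply: perm_mem.
  by rewrite perm_sym in Cw; apply: perm_trans Cw Cw'.
move=> u; rewrite mem_filter mem_permutations; apply/andP/allpairsPdep.
  move=> [avu us]; have xu : x \in u by rewrite (perm_mem us) mem_head.
  case/splitPr: xu avu us => B w avu us.
  have {}us : perm_eq (B ++ w) s.
    by move: us; rewrite -cat1s perm_catCA /= perm_cons.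
  have sub_s y : y \in B ++ w -> (x < y)%N by rewrite (perm_mem us); apply: lt_x.
  have ltB : all (ltn x) B by apply/allP=> y yB; apply: sub_s; rewrite mem_cat yB.
  have ltw : all (ltn x) w by apply/allP=> y yw; apply: sub_s; rewrite mem_cat yw orbT.
  move: avu; rewrite wavoids_min // => /andP[sB avw].
  have UBw : uniq (B ++ w) by rewrite (perm_uniq us).
  have wB y : y \in w -> (y \in B) = false.
    by move: UBw; rewrite cat_uniq => /and3P[_ /hasPn wB _] /wB /negbTE.
  (* Since [s] is a rearrangement of [B ++ w], filtering [s] by membership in [B]
     recovers the splitting from which the word comes. *)
  have fB : [seq y <- B ++ w | y \in B] = B.
    have Bin y : y \in B -> (y \in B) = true by [].
    by rewrite filter_cat (eq_in_filter Bin) (eq_in_filter wB)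
               filter_predT filter_pred0 cats0.
  have fw : [seq y <- B ++ w | y \notin B] = w.
    have Bin y : y \in B -> (y \notin B) = false by move=> ->.
    have wnB y : y \in w -> (y \notin B) = true by move=> /wB ->.
    by rewrite filter_cat (eq_in_filter Bin) (eq_in_filter wnB)
               filter_predT filter_pred0.
  have eqB : [seq y <- s | y \in B] = B.
    apply: (sorted_eq leq_trans anti_leq) => //.
      apply: sorted_filter; first exact: leq_trans.
      by move: ss; rewrite ltn_sorted_uniq_leq => /andP[].
    by rewrite -[X in perm_eq _ X]fB perm_filter // perm_sym.
  exists (B, [seq y <- s | y \notin B]), w; split=> //.
    by rewrite -{1}eqB mem_splits_filter.
  rewrite mem_filter avw mem_permutations /= -[X in perm_eq X _]fw.
  exact: perm_filter.
move=> [[B C] [w [sBC + ->]]] /=.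
rewrite mem_filter mem_permutations => /andP[avw wC].
have [ltB ltC sB _] := splits_sorted _ _ _ _ xs sBC.
have BwS : perm_eq (B ++ w) s by rewrite (perm_trans _ (splits_perm _ _ _ sBC)) // perm_cat2l.
have ltw : all (ltn x) w by rewrite (perm_all _ wC).
rewrite wavoids_min // sB avw; split=> //.
by rewrite -cat1s perm_catCA /= perm_cons.
Qed.

(** * The recurrence for sums over words *)

Lemma wsum_cons x s : sorted ltn (x :: s) ->
  wsum (x :: s) = \sum_(p <- splits s)
    q ^+ cross p.1 p.2 * (q ^+ size p.1 * t ^+ (p.1 != [::]) * wsum p.2).
Proof.
move=> xs; rewrite /wsum -big_filter (perm_big _ (perm_avoiders _ _ xs)) /=.
rewrite big_allpairs_dep; apply: eq_big_seq => -[B C] sBC /=.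
rewrite -[in RHS]big_filter !mulr_sumr; apply: eq_big_seq => w.
rewrite mem_filter mem_permutations => /andP[_ wC].
have [ltB ltC sB _] := splits_sorted _ _ _ _ xs sBC.
have ltw : all (ltn x) w by rewrite (perm_all _ wC).
rewrite /weight winv_min // wdes_min // (perm_cross _ _ _ wC) !exprD; ring.
Qed.

(** [J] stands for the value of [wsum] on alphabets of a given size, so that the
    same lemma serves inside the induction proving that such a value exists, and
    afterwards with [J := Ipol]. *)
Lemma wsum_rec x s (J : nat -> Zqt) : sorted ltn (x :: s) ->
  (forall C, (size C <= size s)%N -> sorted ltn C -> wsum C = J (size C)) ->
  wsum (x :: s) = \sum_(k < (size s).+1)
    gauss (size s) k * (q ^+ (size s - k) * t ^+ (k < size s)%N * J k).
Proof.
move=> xs wsumJ; rewrite wsum_cons //.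
rewrite -(sum_splits _ (fun k => q ^+ (size s - k) * t ^+ (k < size s)%N * J k))
  ?(path_sorted xs) //.
apply: eq_big_seq => -[B C] sBC /=; have [_ _ _ sC] := splits_sorted _ _ _ _ xs sBC.
have szs : size s = (size B + size C)%N.
  by rewrite -size_cat (perm_size (splits_perm _ _ _ sBC)).
rewrite wsumJ // szs ?leq_addl // addnK -[X in (X < _)%N]add0n ltn_add2r lt0n.
by rewrite size_eq0.
Qed.

Lemma wsum_size s : sorted ltn s -> wsum s = wsum (iota 0 (size s)).
Proof.
have [n] := ubnP (size s); elim: n s => // n IHn [|x s] //= lt_sn xs.
have IH C : (size C <= size s)%N -> sorted ltn C -> wsum C = wsum (iota 0 (size C)).
  by move=> leCs; apply: IHn; apply: leq_ltn_trans leCs _.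
have := iota_ltn_sorted 0 (size s).+1 => /= is0.
rewrite (wsum_rec _ _ (fun k => wsum (iota 0 k)) xs IH).
by rewrite (wsum_rec _ _ (fun k => wsum (iota 0 k)) is0) size_iota.
Qed.

(** * Permutations as words *)

Definition word n (s : 'S_n) : seq nat := [seq val (s i) | i <- enum 'I_n].

Lemma size_word n (s : 'S_n) : size (word n s) = n.
Proof. by rewrite size_map size_enum_ord. Qed.

Lemma nth_word n (s : 'S_n) (i : 'I_n) : nth 0%N (word n s) i = s i.
Proof. by rewrite (nth_map i) ?size_enum_ord ?ltn_ord // nth_ord_enum. Qed.

Lemma winvE w : winv w = (\sum_(i < size w) \sum_(j < size w)
  ((i < j)%N && (nth 0%N w j < nth 0%N w i)%N))%N.
Proof.
elim: w => [|x w IHw]; first by rewrite big_ord0.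
rewrite /= big_ord_recl big_ord_recl /= add0n IHw; congr (_ + _)%N.
  by rewrite -sum1_count (big_nth 0%N) big_mkord big_mkcond.
by apply: eq_bigr => i _; rewrite big_ord_recl.
Qed.

Lemma wdesE w : wdes w = (\sum_(i < size w)
  ((i.+1 < size w)%N && (nth 0%N w i.+1 < nth 0%N w i)%N))%N.
Proof.
elim: w => [|x w IHw]; first by rewrite big_ord0.
by rewrite /= big_ord_recl /= IHw; case: w {IHw} => [|y w] //=; rewrite !big_ord0.
Qed.

Lemma wavoidsPn w : reflect
  (exists i j, [/\ (i.+1 < j)%N, (j < size w)%N, (nth 0%N w i.+1 < nth 0%N w i)%N
                 & (nth 0%N w j < nth 0%N w i.+1)%N])
  (~~ wavoids w).
Proof.
elim: w => [|x w IHw] /=; first by right=> -[i [j []]].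
rewrite negb_and; apply: (iffP orP) => [[] | [[|i] [[|j] [] //= lt_ij ltj d1 d2]]].
- case: w {IHw} => //= y w; rewrite negb_imply => /andP[lt_yx /allPn[z zw]].
  rewrite -ltnNge => lt_zy; exists 0%N, (index z w).+2.
  by rewrite /= !ltnS index_mem nth_index.
- by move=> /IHw[i [j [? ? ? ?]]]; exists i.+1, j.+1.
- left; case: w {IHw} lt_ij ltj d1 d2 => [|y w] //= lt_ij ltj d1 d2.
  rewrite negb_imply d1; case: j lt_ij ltj d2 => //= j _ ltj d2.
  by apply/allPn; exists (nth 0%N w j); rewrite ?mem_nth // -ltnNge.
- by right; apply/IHw; exists i, j.
Qed.

(* The unqualified name would denote the inverse of a permutation. *)
Lemma perm_invE n (s : 'S_n) : Defs.perm_inv s = winv (word n s).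
Proof.
rewrite winvE size_word /Defs.perm_inv -sum1dep_card big_mkcond /=.
rewrite (pair_bigA _ (fun i j : 'I_n =>
  (i < j)%N && (nth 0%N (word n s) j < nth 0%N (word n s) i)%N : nat)) /=.
by apply: eq_bigr => -[i j] _ /=; rewrite !nth_word; case: ifP.
Qed.

Lemma perm_desE n (s : 'S_n) : perm_des s = wdes (word n s).
Proof.
rewrite wdesE size_word /perm_des -sum1dep_card big_mkcond /=.
apply: eq_bigr => i _; rewrite nth_word.
suff -> : [exists i' : 'I_n, (i' == i.+1 :> nat) && (s i' < s i)%N]
   = (i.+1 < n)%N && (nth 0%N (word n s) i.+1 < s i)%N by case: ifP.
apply/existsP/andP => [[j /andP[/eqP <- d]]|[lt_in d]]; first by rewrite nth_word.
by exists (Ordinal lt_in); rewrite eqxx -(nth_word _ s).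
Qed.

Lemma contains_word n (s : 'S_n) : contains_vincular321 s = ~~ wavoids (word n s).
Proof.
apply/existsP/wavoidsPn => [[i /existsP[i' /existsP[j]]] | [i [j [lt_ij]]]].
  case/and4P=> /eqP Di' lt_ij d1 d2; exists i, j.
  by rewrite -Di' size_word !nth_word.
rewrite size_word => ltj d1 d2; have lti' := ltn_trans lt_ij ltj.
exists (Ordinal (ltnW lti')); apply/existsP; exists (Ordinal lti').
apply/existsP; exists (Ordinal ltj).
by rewrite -!(nth_word _ s) /= eqxx lt_ij d1.
Qed.

Lemma word_inj n : injective (word n).
Proof.
by move=> s1 s2 eqw; apply/permP => i; apply: val_inj; rewrite /= -!nth_word eqw.
Qed.

(** Injectivity suffices, since there are n! permutations and n! arrangements. *)
Lemma perm_word n : perm_eq [seq word n s | s : 'S_n] (permutations (iota 0 n)).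
Proof.
have Uw : uniq [seq word n s | s : 'S_n].
  by rewrite map_inj_uniq ?enum_uniq //; apply: word_inj.
apply: uniq_perm; rewrite ?permutations_uniq //.
have sub : {subset [seq word n s | s : 'S_n] <= permutations (iota 0 n)}.
  move=> _ /mapP[s _ ->]; rewrite mem_permutations -val_enum_ord /word map_comp.
  apply/perm_map/uniq_perm; rewrite ?(map_inj_uniq (@perm_inj _ s)) ?enum_uniq //.
  by move=> i; rewrite mem_enum -[i](permKV s) map_f ?mem_enum.
have [] // := uniq_min_size Uw sub.
rewrite size_permutations ?iota_uniq // size_iota size_map -cardE.
by rewrite card_Sn.
Qed.

Lemma Ipol_wsum n : Ipol n = wsum (iota 0 n).
Proof.
case: n => [|n].
  by rewrite /wsum -big_filter big_seq1 /weight /= !expr0 mulr1.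
rewrite /wsum -(perm_big _ (perm_word n.+1)) /= big_map big_enum_cond /=.
apply: eq_big => s; first by rewrite inE contains_word negbK.
by rewrite /weight perm_invE perm_desE.
Qed.

Theorem theorem2p5 (n : nat) (hn : (1 <= n)%N) :
  tofrac (Ipol n) =
    \sum_(0 <= k < n.-1)
      tofrac t * tofrac q ^+ (n - k - 1) * qbinom (n - 1) k * tofrac (Ipol k)
    + tofrac (Ipol (n - 1)) :> Qqt.
Proof.
case: n hn => // n _; rewrite subn1 succnK big_mkord (Ipol_wsum n.+1).
have n_sorted := iota_ltn_sorted 0 n.+1.
rewrite -[wsum _]/(wsum (0%N :: iota 1 n)).
rewrite (wsum_rec _ _ Ipol n_sorted) => [|C _ sC]; last by rewrite wsum_size // Ipol_wsum.
(* The last term, [k = n], is the one of empty prefix and carries no [t]. *)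
rewrite size_iota big_ord_recr /= gauss_diag subnn ltnn !mul1r rmorphD rmorph_sum.
congr (_ + _); apply: eq_bigr => k _ /=.
rewrite ltn_ord expr1 qbinom_gauss ?(ltnW (ltn_ord k)) //.
rewrite -subnDA addn1 subSS !rmorphM rmorphXn /=; ring.
Qed.
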